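(* Consider a planar non-collinear four-body central configuration with $\alpha_{23}^\perp,\alpha_{24}^\perp,\alpha_{34}^\perp\neq0$. Let $\mathbf v=\mathbb J\mathbf q$ be the rotational mode, $\mathcal W=\mathbf v^\perp\subset\mathbb R^6$, $\mathbf W=\mathbf w\otimes\mathbf I_2\in\mathbb R^{6\times2}$, and recall $\widetilde L=\sigma\mathbf W\mathbf W^T$ with $\sigma\neq0$, where $\mathbf w=(1/\alpha_{34}^\perp,1/\alpha_{24}^\perp,1/\alpha_{23}^\perp)^T$ and $\sigma=-\alpha_{23}^\perp\alpha_{24}^\perp\alpha_{34}^\perp$. Then the nonzero generalized eigenvalues of the pair $(\widetilde L|_{\mathcal W},L^\Delta|_{\mathcal W})$ coincide with the eigenvalues of the $2\times2$ matrix $$\Omega:=\sigma\,\mathbf W^T(L^\Delta_{\mathrm{reg}})^{-1}\mathbf W .$$ In particular, $H_{\mathcal C}|_{\mathcal W}=L^\Delta|_{\mathcal W}+\widetilde L|_{\mathcal W}$ is positive definite if and only if both eigenvalues of $\Omega$ are greater than $-1$.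
   Context: Four bodies have masses $m_1,\dots,m_4>0$, $M=\sum_i m_i$, pairwise distinct positions $\mathbf r_i\in\mathbb R^2$ with $\sum_i m_i\mathbf r_i=0$; $\mathbf q_{ij}=\mathbf r_i-\mathbf r_j$, $q_{ij}=|\mathbf q_{ij}|$, $\hat{\mathbf q}_{ij}=\mathbf q_{ij}/q_{ij}$, $\mu_{ij}=m_im_j/M$. The configuration is central if there is $\omega^2>0$ with $\omega^2m_i\mathbf r_i=\sum_{j\ne i}\frac{m_im_j}{q_{ij}^3}\mathbf q_{ij}$ for all $i$ (such $\omega^2$ is then uniquely determined). It is non-collinear if the four positions do not lie on one line. Put $\alpha_{ij}^\perp=\alpha_{ji}^\perp=\mu_{ij}(\omega^2-M/q_{ij}^3)$, $\delta_{ij}=3M\mu_{ij}/q_{ij}^3$, $\mathbf D_{ij}=\mathbf D_{ji}=\delta_{ij}\hat{\mathbf q}_{ij}\hat{\mathbf q}_{ij}^T$. With indices $a,b\in\{2,3,4\}$ and sums over $k\in\{1,2,3,4\}$, $k\ne a$: $\ell\in\mathbb R^{3\times3}$ is $\ell_{a-1,a-1}=\sum_{k\ne a}\alpha_{ak}^\perp$, $\ell_{a-1,b-1}=-\alpha_{ab}^\perp$ $(a\ne b)$; $\widetilde L=\ell\otimes\mathbf I_2\in\mathbb R^{6\times6}$; the gap Laplacian $L^\Delta\in\mathbb R^{6\times6}$ is the $3\times3$ array of $2\times2$ blocks $(L^\Delta)_{a-1,a-1}=\sum_{k\ne a}\mathbf D_{ak}$, $(L^\Delta)_{a-1,b-1}=-\mathbf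 D_{ab}$ $(a\neq b)$; the restricted Hessian is $H_{\mathcal C}=L^\Delta+\widetilde L$. $\mathbf q=(\mathbf q_{12}^T,\mathbf q_{13}^T,\mathbf q_{14}^T)^T\in\mathbb R^6$, $\mathbf J=\begin{pmatrix}0&-1\\1&0\end{pmatrix}$, $\mathbb J=\mathbf I_3\otimes\mathbf J$, and $L^\Delta_{\mathrm{reg}}=L^\Delta+\frac{\mathbf v\mathbf v^T}{\|\mathbf v\|^2}$, which is positive definite. Restrictions to $\mathcal W$ are restrictions of the associated quadratic forms (equivalently operators, since $L^\Delta$ and $\widetilde L$ map $\mathcal W$ to itself). A generalized eigenvalue of $(\widetilde L|_{\mathcal W},L^\Delta|_{\mathcal W})$ is a number $\lambda$ for which there is a nonzero $\mathbf x\in\mathcal W$ with $\widetilde L\mathbf x=\lambda L^\Delta\mathbf x$. *)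

(* Defs.v *)
From HB Require Import structures.
From mathcomp Require Import all_boot all_order all_algebra.
From mathcomp Require Import reals mxtens.

Set Implicit Arguments.
Unset Strict Implicit.
Unset Printing Implicit Defensive.

Import Order.TTheory GRing.Theory Num.Theory.
Local Open Scope ring_scope.

Section LinearAlgebra.
Variable R : realType.

Definition dot n (x y : 'cV[R]_n) : R := \sum_i x i 0 * y i 0.

(* The Euclidean norm; the norm that MathComp-Analysis puts on matrices is the
   sup norm. *)
Definition norm2 n (x : 'cV[R]_n) : R := Num.sqrt (dot x x).

(* The vector space 'cV_(m * n) is R^m (x) R^n, as for the product [*t] of
   mxtens: coordinate [a * n + i] is coordinate i of the a-th block of size n. *)
Definition block_col m n (u : 'I_m -> 'cV[R]_n) : 'cV[R]_(m * n) :=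
  \col_s u (mxtens_unindex s).1 (mxtens_unindex s).2 0.

Definition block_square m n (B : 'I_m -> 'I_m -> 'M[R]_n) : 'M[R]_(m * n) :=
  \matrix_(s, t) B (mxtens_unindex s).1 (mxtens_unindex t).1
                   (mxtens_unindex s).2 (mxtens_unindex t).2.

Definition Jmx : 'M[R]_2 :=
  \matrix_(i < 2, j < 2) (nth [::] [:: [:: 0; -1]; [:: 1; 0]] i)`_j.

Definition posdef_on_orth n (v : 'cV[R]_n) (A : 'M[R]_n) : Prop :=
  forall x : 'cV[R]_n, x != 0 -> dot v x = 0 -> 0 < dot x (A *m x).

Definition gen_eigenvalue_on_orth n (v : 'cV[R]_n) (A B : 'M[R]_n) (lam : R) :
    Prop :=
  exists x : 'cV[R]_n, [/\ x != 0, dot v x = 0 & A *m x = lam *: (B *m x)].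

End LinearAlgebra.

(* Bodies 1, 2, 3, 4 are the elements 0, 1, 2, 3 of 'I_4. *)
Definition body1 : 'I_4 := @Ordinal 4 0 isT.
Definition body2 : 'I_4 := @Ordinal 4 1 isT.
Definition body3 : 'I_4 := @Ordinal 4 2 isT.
Definition body4 : 'I_4 := @Ordinal 4 3 isT.

(* The body a in {2, 3, 4} whose row (or block row) has index a - 1 in the
   1-based numbering of the rows. *)
Definition body_of_row (a : 'I_3) : 'I_4 := lift body1 a.

Section FourBodies.
Variable R : realType.
Variables (m : 'I_4 -> R) (r : 'I_4 -> 'cV[R]_2).

Definition total_mass : R := \sum_i m i.
Definition qvec (i j : 'I_4) : 'cV[R]_2 := r i - r j.
Definition qdist (i j : 'I_4) : R := norm2 (qvec i j).
Definition qhat (i j : 'I_4) : 'cV[R]_2 := (qdist i j)^-1 *: qvec i j.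
Definition mu (i j : 'I_4) : R := m i * m j / total_mass.

Definition central_eq (omega2 : R) : Prop :=
  forall i, (omega2 * m i) *: r i =
    \sum_(j < 4 | j != i) (m i * m j / qdist i j ^+ 3) *: qvec i j.

Definition on_a_line : Prop :=
  exists p d : 'cV[R]_2, d != 0 /\ forall i, exists t : R, r i = p + t *: d.

Definition delta (i j : 'I_4) : R := 3 * total_mass * mu i j / qdist i j ^+ 3.
Definition Dmx (i j : 'I_4) : 'M[R]_2 :=
  delta i j *: (qhat i j *m (qhat i j)^T).

Definition gap_laplacian : 'M[R]_(3 * 2) :=
  block_square (fun a b : 'I_3 =>
    if a == b
    then \sum_(k < 4 | k != body_of_row a) Dmx (body_of_row a) k
    else - Dmx (body_of_row a) (body_of_row b)).

Definition qcol : 'cV[R]_(3 * 2) :=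
  block_col (fun a : 'I_3 => qvec body1 (body_of_row a)).

Definition rot_mode : 'cV[R]_(3 * 2) := ((1%:M : 'M[R]_3) *t Jmx R) *m qcol.

Definition gap_laplacian_reg : 'M[R]_(3 * 2) :=
  gap_laplacian + (norm2 rot_mode ^+ 2)^-1 *: (rot_mode *m rot_mode^T).

Variable omega2 : R.

Definition alpha_perp (i j : 'I_4) : R :=
  mu i j * (omega2 - total_mass / qdist i j ^+ 3).

Definition ell : 'M[R]_3 :=
  \matrix_(a < 3, b < 3)
    if a == b
    then \sum_(k < 4 | k != body_of_row a) alpha_perp (body_of_row a) k
    else - alpha_perp (body_of_row a) (body_of_row b).

Definition Ltilde : 'M[R]_(3 * 2) := ell *t (1%:M : 'M[R]_2).

Definition restricted_hessian : 'M[R]_(3 * 2) := gap_laplacian + Ltilde.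

Definition wvec : 'cV[R]_3 :=
  \col_(a < 3) [:: (alpha_perp body3 body4)^-1;
                   (alpha_perp body2 body4)^-1;
                   (alpha_perp body2 body3)^-1]`_a.

Definition sigma : R :=
  - (alpha_perp body2 body3 * alpha_perp body2 body4 * alpha_perp body3 body4).

Definition Wmx : 'M[R]_(3 * 2, 2) := wvec *t (1%:M : 'M[R]_2).

Definition Omega : 'M[R]_2 :=
  sigma *: (Wmx^T *m invmx gap_laplacian_reg *m Wmx).

End FourBodies.

(* Main.v *)
(* The barycenter and central equations say that the alpha_ij form an
   equilibrium stress, so both coordinate columns of the q_1a lie in the kernel of
   ell; as the bodies are not on a line, these columns are independent, all
   2 x 2 minors of ell vanish, and ell = sigma w w^T. The gap Laplacian is the
   stiffness matrix of the complete graph with body 1 pinned: it is nonnegative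
   and, by infinitesimal rigidity, its kernel is spanned by v. Hence A = L_reg
   agrees with the gap Laplacian on W and W^T v = 0, so y |-> A^-1 W y carries
   eigenvectors of Omega to generalized eigenvectors in W. *)
Require Import Defs.
From HB Require Import structures.
From mathcomp Require Import all_boot all_order all_algebra.
From mathcomp Require Import reals mxtens.
From mathcomp Require Import ring lra.

Set Implicit Arguments.
Unset Strict Implicit.
Unset Printing Implicit Defensive.

Import Order.TTheory GRing.Theory Num.Theory.
Local Open Scope ring_scope.

(** * Algebra of the dot product *)

Lemma dotE (R : realType) n (x y : 'cV[R]_n) : dot x y = (x^T *m y) 0 0.
Proof. by rewrite /dot mxE; apply: eq_bigr => i _; rewrite mxE. Qed.

Lemma dotC (R : realType) n (x y : 'cV[R]_n) : dot x y = dot y x.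
Proof. by apply: eq_bigr => i _; rewrite mulrC. Qed.

Lemma dot0r (R : realType) n (x : 'cV[R]_n) : dot x 0 = 0.
Proof. by rewrite dotE mulmx0 mxE. Qed.

Lemma dotDr (R : realType) n (x y z : 'cV[R]_n) :
  dot x (y + z) = dot x y + dot x z.
Proof. by rewrite !dotE mulmxDr mxE. Qed.

Lemma dotZr (R : realType) n a (x y : 'cV[R]_n) : dot x (a *: y) = a * dot x y.
Proof. by rewrite !dotE -scalemxAr mxE. Qed.

Lemma dotDl (R : realType) n (x y z : 'cV[R]_n) :
  dot (y + z) x = dot y x + dot z x.
Proof. by rewrite dotC dotDr !(dotC x). Qed.

Lemma dotZl (R : realType) n a (x y : 'cV[R]_n) : dot (a *: x) y = a * dot x y.
Proof. by rewrite dotC dotZr dotC. Qed.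

Lemma dotNr (R : realType) n (x y : 'cV[R]_n) : dot x (- y) = - dot x y.
Proof. by rewrite -scaleN1r dotZr mulN1r. Qed.

Lemma dotNl (R : realType) n (x y : 'cV[R]_n) : dot (- x) y = - dot x y.
Proof. by rewrite dotC dotNr dotC. Qed.

Lemma dot_mulmxr (R : realType) n p (A : 'M[R]_(n, p)) (x : 'cV_n) (y : 'cV_p) :
  dot x (A *m y) = dot (A^T *m x) y.
Proof. by rewrite !dotE trmx_mul trmxK mulmxA. Qed.

Lemma dot_self_ge0 (R : realType) n (x : 'cV[R]_n) : 0 <= dot x x.
Proof. by apply: sumr_ge0 => i _; rewrite -expr2 sqr_ge0. Qed.

Lemma dot_self_eq0 (R : realType) n (x : 'cV[R]_n) : (dot x x == 0) = (x == 0).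
Proof.
apply/eqP/eqP => [x0|->]; last exact: dot0r.
apply/colP => i; rewrite mxE; apply/eqP.
have /eqP := psumr_eq0P (fun i _ => sqr_ge0 (x i 0)) x0 (i := i) isT.
by rewrite mulf_eq0 orbb.
Qed.

Lemma dot_self_gt0 (R : realType) n (x : 'cV[R]_n) : x != 0 -> 0 < dot x x.
Proof. by move=> x0; rewrite lt_def dot_self_ge0 dot_self_eq0 x0. Qed.

Lemma sqr_norm2 (R : realType) n (x : 'cV[R]_n) : norm2 x ^+ 2 = dot x x.
Proof. exact: sqr_sqrtr (dot_self_ge0 x). Qed.

(** * Symmetric matrices, their eigenvalues and quadratic forms *)

Lemma posdef_unitmx (R : realType) n (A : 'M[R]_n) :
  (forall x : 'cV_n, x != 0 -> 0 < dot x (A *m x)) -> A \in unitmx.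
Proof.
move=> Apd; rewrite -unitmx_tr -row_free_unit -kermx_eq0; apply/eqP/row_matrixP => i.
apply/eqP; rewrite row0; apply/eqP; set u := row i _.
have uA : u *m A^T = 0 by rewrite -row_mul mulmx_ker row0.
(* If [u] were nonzero, [A] would kill its transpose and the form would vanish there. *)
apply: trmx_inj; rewrite trmx0; apply/eqP/negPn/negP => /Apd.
by rewrite -[A]trmxK -trmx_mul uA trmx0 dot0r ltxx.
Qed.

(** [eigenvalue] refers to row vectors multiplied on the right by [A]; symmetry allows transposing
    to columns. *)
Lemma eigenvalue_sym (R : realType) n (A : 'M[R]_n) (a : R) : A^T = A ->
  reflect (exists2 y : 'cV_n, A *m y = a *: y & y != 0) (eigenvalue A a).
Proof.
move=> sA; apply: (iffP eigenvalueP) => -[y Ay y0]; exists y^T;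
  rewrite -?[_ == 0](inj_eq trmx_inj) ?trmxK ?trmx0 //;
  by rewrite -{1}sA -trmx_mul Ay linearZ.
Qed.

Lemma char_poly_mx22 (R : realType) (A : 'M[R]_2) :
  char_poly A = ('X - (A 0 0)%:P) * ('X - (A 1 1)%:P) - (A 0 1 * A 1 0)%:P.
Proof.
rewrite /char_poly (expand_det_row _ 0) !big_ord_recl big_ord0 /cofactor !det_mx11.
have -> : lift ord0 ord0 = 1 :> 'I_2 by apply: val_inj.
rewrite !mxE /=.
have -> : lift 0 (0 : 'I_1) = 1 :> 'I_2 by apply: val_inj.
have -> : lift 1 (0 : 'I_1) = 0 :> 'I_2 by apply: val_inj.
rewrite polyCM; ring.
Qed.

(** The discriminant tr^2 - 4 det equals (A00 - A11)^2 + 4 A01^2 >= 0, so the quadratic formula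
    gives two real roots. *)
Lemma sym_mx22_char_poly_split (R : realType) (A : 'M[R]_2) : A^T = A ->
  exists l1 l2 : R, [/\ char_poly A = ('X - l1%:P) * ('X - l2%:P),
    l1 + l2 = A 0 0 + A 1 1 & l1 * l2 = A 0 0 * A 1 1 - A 0 1 ^+ 2].
Proof.
move=> sA; have A10 : A 1 0 = A 0 1 by rewrite -{1}sA mxE.
pose d := Num.sqrt ((A 0 0 - A 1 1) ^+ 2 + 4 * A 0 1 ^+ 2).
have d2 : d ^+ 2 = (A 0 0 - A 1 1) ^+ 2 + 4 * A 0 1 ^+ 2.
  by apply: sqr_sqrtr; have := sqr_ge0 (A 0 0 - A 1 1); have := sqr_ge0 (A 0 1); lra.
exists ((A 0 0 + A 1 1 + d) / 2), ((A 0 0 + A 1 1 - d) / 2).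
set l1 := _ / 2; set l2 := _ / 2.
have s : l1 + l2 = A 0 0 + A 1 1 by rewrite /l1 /l2; lra.
have p : l1 * l2 = A 0 0 * A 1 1 - A 0 1 ^+ 2.
  have -> : l1 * l2 = ((A 0 0 + A 1 1) ^+ 2 - d ^+ 2) / 4 by rewrite /l1 /l2; field.
  by rewrite d2; field.
split=> //.
have sP : l1%:P + l2%:P = (A 0 0)%:P + (A 1 1)%:P :> {poly R} by rewrite -!polyCD s.
have pP : l1%:P * l2%:P = (A 0 0)%:P * (A 1 1)%:P - (A 0 1 * A 0 1)%:P :> {poly R}.
  by rewrite -!polyCM -polyCB p -expr2.
rewrite char_poly_mx22 A10.
have -> : ('X - l1%:P) * ('X - l2%:P) = 'X * 'X - (l1%:P + l2%:P) * 'X + l1%:P * l2%:P by ring.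
rewrite sP pP; ring.
Qed.

(** Sylvester's criterion for I + A, whose determinant is (1 + l1)(1 + l2) > 0. *)
Lemma sym_mx22_posdef_shift (R : realType) (A : 'M[R]_2) (l1 l2 : R) (y : 'cV_2) :
  A^T = A -> l1 + l2 = A 0 0 + A 1 1 -> l1 * l2 = A 0 0 * A 1 1 - A 0 1 ^+ 2 ->
  -1 < l1 -> -1 < l2 -> y != 0 -> 0 < dot y y + dot y (A *m y).
Proof.
move=> sA s p h1 h2 y0; have A10 : A 1 0 = A 0 1 by rewrite -{1}sA mxE.
rewrite /dot !big_ord_recl !big_ord0 !mxE !big_ord_recl !big_ord0 /=.
have -> : lift ord0 ord0 = 1 :> 'I_2 by apply: val_inj.
rewrite A10 !addr0.
have : (y 0 0 != 0) || (y 1 0 != 0).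
  rewrite -negb_and; apply: contra y0 => /andP[/eqP ya /eqP yb].
  apply/eqP/colP => i; rewrite mxE; case: i => -[|[|//]] i.
    by rewrite -ya; congr (y _ _); apply: val_inj.
  by rewrite -yb; congr (y _ _); apply: val_inj.
move: s p; set a := A 0 0; set b := A 0 1; set d := A 1 1.
set u := y 0 0; set w := y 1 0 => s p uw.
have D : 0 < (1 + a) * (1 + d) - b ^+ 2.
  have -> : (1 + a) * (1 + d) - b ^+ 2 = (1 + l1) * (1 + l2) by lra.
  by rewrite mulr_gt0 //; lra.
have b2 := sqr_ge0 b.
(* The trace (1 + l1) + (1 + l2) of I + A is positive, so 1 + a <= 0 would force 1 + d >= 0 and a
   determinant <= 0. *)
have a1 : 0 < 1 + a.
  rewrite ltNge; apply/negP => a1; have d1 : 0 <= 1 + d by lra.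
  have : 0 <= - (1 + a) * (1 + d) by rewrite mulr_ge0 // oppr_ge0.
  lra.
(* After multiplication by 1 + a > 0 the square can be completed. *)
rewrite -(pmulr_rgt0 _ a1).
have -> : (1 + a) * (u * u + w * w + (u * (a * u + b * w) + w * (b * u + d * w))) =
  ((1 + a) * u + b * w) ^+ 2 + ((1 + a) * (1 + d) - b ^+ 2) * w ^+ 2 by ring.
have [w0|w0] := eqVneq w 0.
  move: uw; rewrite w0 eqxx orbF => u0.
  by rewrite !mulr0 expr0n mulr0 !addr0 exprn_even_gt0 //= mulf_neq0 // gt_eqF.
by rewrite ltr_wpDl ?sqr_ge0 // mulr_gt0 // exprn_even_gt0.
Qed.

(** * Rank-one regularization along a kernel vector *)

Definition regularize (R : realType) n (v : 'cV[R]_n) (L : 'M[R]_n) : 'M[R]_n :=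
  L + (norm2 v ^+ 2)^-1 *: (v *m v^T).

Lemma mulmx_regularize (R : realType) n (v : 'cV[R]_n) (L : 'M[R]_n) x :
  regularize v L *m x = L *m x + (dot v x / dot v v) *: v.
Proof.
rewrite mulmxDl -scalemxAl -mulmxA [v^T *m x]mx11_scalar -dotE mul_mx_scalar.
by rewrite scalerA sqr_norm2 mulrC.
Qed.

(** Split x = z + t v with z orthogonal to v. Since L v = 0, the form becomes z^T L z + t^2 |v|^2,
    and z and t are not both zero. *)
Lemma regularize_posdef (R : realType) n (v : 'cV[R]_n) (L : 'M[R]_n) x :
  v != 0 -> L^T = L -> L *m v = 0 -> posdef_on_orth v L -> x != 0 ->
  0 < dot x (regularize v L *m x).
Proof.
move=> v0 sL Lv Lpd x0; have vv := dot_self_gt0 v0.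
pose t := dot v x / dot v v; pose z := x - t *: v.
have xE : x = z + t *: v by rewrite subrK.
have vz : dot v z = 0.
  by rewrite dotDr -scaleNr dotZr mulNr divfK ?subrr // gt_eqF.
have Lx : L *m x = L *m z by rewrite xE mulmxDr -scalemxAr Lv scaler0 addr0.
have -> : dot x (regularize v L *m x) = dot z (L *m z) + t ^+ 2 * dot v v.
  rewrite mulmx_regularize -/t dotDr Lx {1}xE dotDl dotZl (dot_mulmxr L v).
  rewrite sL Lv (dotC 0) dot0r mulr0 addr0 dotZr (dotC x) {1}xE dotDr vz dotZr.
  ring.
have [z0|z0] := eqVneq z 0; last first.
  by rewrite ltr_pwDl ?Lpd // mulr_ge0 ?sqr_ge0 // ltW.
rewrite z0 mulmx0 dot0r add0r mulr_gt0 // exprn_even_gt0 //=.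
by apply: contra x0 => /eqP t0; rewrite xE z0 t0 scale0r addr0.
Qed.

(** * Low-rank perturbation of a form that is definite on the complement of its kernel *)

Section LowRankPerturbation.

Variables (R : realType) (n p : nat) (v : 'cV[R]_n) (L : 'M[R]_n).
Variables (W : 'M[R]_(n, p)) (s : R).
Hypotheses (v0 : v != 0) (sL : L^T = L) (Lv : L *m v = 0).
Hypotheses (Lpd : posdef_on_orth v L) (Wv : W^T *m v = 0).
Hypotheses (Winj : forall y : 'cV_p, W *m y = 0 -> y = 0) (s0 : s != 0).

Let A := regularize v L.
Let Om := s *: (W^T *m invmx A *m W).

Let Apd x : x != 0 -> 0 < dot x (A *m x).
Proof. exact: regularize_posdef. Qed.

Let unitA : A \in unitmx.
Proof. exact: posdef_unitmx Apd. Qed.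

Let symA : A^T = A.
Proof. by rewrite /A /regularize !linearD linearZ /= trmx_mul trmxK sL. Qed.

Lemma capacitance_sym : Om^T = Om.
Proof. by rewrite /Om linearZ /= !trmx_mul trmxK trmx_inv symA mulmxA. Qed.

Let A_orth x : dot v x = 0 -> A *m x = L *m x.
Proof. by move=> vx; rewrite mulmx_regularize vx mul0r scale0r addr0. Qed.

(** Sends eigenvectors of [Om] to generalized eigenvectors; x |-> W^T x goes back, up to a
    scalar. *)
Let lift_ev (y : 'cV_p) : 'cV_n := invmx A *m (W *m y).

Let A_lift y : A *m lift_ev y = W *m y.
Proof. exact: mulKVmx. Qed.

(** Since A v = v and A is symmetric, v^T A^-1 W y = v^T W y, which vanishes because W^T v = 0. *)
Let lift_orth y : dot v (lift_ev y) = 0.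
Proof.
have Av : A *m v = v by rewrite mulmx_regularize Lv add0r divff ?scale1r ?dot_self_eq0.
by rewrite -{1}Av -{1}symA -dot_mulmxr A_lift dot_mulmxr Wv dotC dot0r.
Qed.

Let W_lift y : s *: (W^T *m lift_ev y) = Om *m y.
Proof. by rewrite /lift_ev /Om -scalemxAl !mulmxA. Qed.

Let lift_neq0 y : y != 0 -> lift_ev y != 0.
Proof.
by apply: contra => /eqP y0; apply/eqP/Winj; rewrite -A_lift y0 mulmx0.
Qed.

(** [Om] is s times a positive definite form pulled back along an injective map; this excludes the
    eigenvalue 0. *)
Let dot_capacitance y : dot y (Om *m y) = s * dot (lift_ev y) (A *m lift_ev y).
Proof. by rewrite A_lift -W_lift dotZr (dot_mulmxr W) dotC. Qed.

Lemma capacitance_eigenvalueP lam :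
  (lam != 0 /\ gen_eigenvalue_on_orth v (s *: (W *m W^T)) L lam)
  <-> eigenvalue Om lam.
Proof.
split=> [[lam0 [x [x0 vx]]]|].
  rewrite -(A_orth vx) -scalemxAl -mulmxA => Wx.
  (* On the complement of v, L may be replaced by A, which can then be inverted. *)
  have ex : s *: lift_ev (W^T *m x) = lam *: x.
    by rewrite /lift_ev scalemxAr Wx -scalemxAr mulKmx.
  apply/(eigenvalue_sym lam capacitance_sym); exists (W^T *m x).
    by rewrite -W_lift scalemxAr ex -scalemxAr.
  (* If W^T x = 0, then lam x = 0 with lam nonzero. *)
  apply: contra x0 => /eqP Wx0; move/eqP: ex.
  by rewrite /lift_ev Wx0 !mulmx0 scaler0 eq_sym scaler_eq0 (negPf lam0).
case/(eigenvalue_sym lam capacitance_sym) => y Omy y0; split.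
  apply/eqP => lam0; have := dot_capacitance y.
  rewrite Omy lam0 scale0r dot0r => /esym/eqP.
  by rewrite mulf_eq0 (negPf s0) gt_eqF // Apd // lift_neq0.
exists (lift_ev y); rewrite lift_orth lift_neq0 //; split=> //.
by rewrite -A_orth // A_lift -scalemxAl -mulmxA scalemxAr W_lift Omy -scalemxAr.
Qed.

(** At x = A^-1 W y the perturbed form is (1 + lam) x^T A x, so its positivity gives 1 + lam > 0. *)
Lemma eigenvalue_gtN1 lam :
  posdef_on_orth v (L + s *: (W *m W^T)) -> eigenvalue Om lam -> -1 < lam.
Proof.
move=> Hpd /(eigenvalue_sym lam capacitance_sym)[y Omy y0].
have := Hpd _ (lift_neq0 y0) (lift_orth y).
rewrite mulmxDl -(A_orth (lift_orth y)) -scalemxAl -mulmxA scalemxAr W_lift Omy.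
rewrite -scalemxAr -A_lift -{1}[A *m _]scale1r -scalerDl dotZr.
by rewrite pmulr_lgt0 ?Apd ?lift_neq0 // -ltrBlDl sub0r.
Qed.

Lemma posdef_perturbation :
  (forall y : 'cV_p, y != 0 -> 0 < dot y y + dot y (Om *m y)) ->
  posdef_on_orth v (L + s *: (W *m W^T)).
Proof.
move=> Ompd x x0 vx; pose y := W^T *m x.
have xL : 0 < dot x (L *m x) by exact: Lpd.
have -> : dot x ((L + s *: (W *m W^T)) *m x) = dot x (L *m x) + s * dot y y.
  by rewrite mulmxDl dotDr -scalemxAl dotZr -mulmxA (dot_mulmxr W).
(* For s > 0 the added term s y^T y only raises the form; the square is completed for s < 0. *)
have [s_gt0|s_le0] := ltP 0 s.
  by rewrite ltr_pwDl // mulr_ge0 ?dot_self_ge0 // ltW.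
have [y0|y0] := eqVneq y 0; first by rewrite y0 dot0r mulr0 addr0.
(* Complete the square: with [z = x + s A^-1 W y],
   [x^T L x + s y^T y = z^T A z - s (y^T y + y^T Om y)]. *)
pose z := x + s *: lift_ev y.
have zA : dot z (A *m z) = dot x (L *m x) + s * dot y y + s * (dot y y + dot y (Om *m y)).
  rewrite /z mulmxDr -scalemxAr A_orth // A_lift !(dotDl, dotDr, dotZl, dotZr).
  rewrite -(A_orth vx) (dot_mulmxr A (lift_ev y)) symA A_lift (dotC (W *m y)).
  rewrite !(dot_mulmxr W) -/y (dotC _ y) (dot_capacitance y) A_lift.
  rewrite (dot_mulmxr W) (dotC _ y) A_orth //; ring.
have z_ge0 : 0 <= dot z (A *m z).
  by have [->|/Apd/ltW//] := eqVneq z 0; rewrite mulmx0 dot0r.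
have s_lt0 : s < 0 by rewrite lt_neqAle s0.
have := Ompd y y0; rewrite -(nmulr_rlt0 _ s_lt0); lra.
Qed.

End LowRankPerturbation.

(** * Block vectors, block matrices and Kronecker products *)

Lemma sum_mxtens (V : nmodType) m n (F : 'I_(m * n) -> V) :
  \sum_s F s = \sum_a \sum_i F (mxtens_index (a, i)).
Proof.
rewrite pair_bigA /= (reindex (@mxtens_index m n)) /=.
  by apply: eq_bigr => -[].
by exists (@mxtens_unindex m n) => i _; rewrite (mxtens_indexK, mxtens_unindexK).
Qed.

Lemma block_colE (R : realType) m n (x : 'cV[R]_(m * n)) :
  x = block_col (fun a => \col_i x (mxtens_index (a, i)) 0).
Proof. by apply/colP => s; rewrite !mxE -surjective_pairing mxtens_unindexK. Qed.

Lemma eq_block_col (R : realType) m n (u w : 'I_m -> 'cV[R]_n) :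
  u =1 w -> block_col u = block_col w.
Proof. by move=> uw; apply/colP => s; rewrite !mxE uw. Qed.

Lemma block_col0 (R : realType) m n : block_col (fun=> 0) = 0 :> 'cV[R]_(m * n).
Proof. by apply/colP => s; rewrite !mxE. Qed.

Lemma block_colZ (R : realType) m n c (u : 'I_m -> 'cV[R]_n) :
  c *: block_col u = block_col (fun a => c *: u a).
Proof. by apply/colP => s; rewrite !mxE. Qed.

Lemma dot_block_col (R : realType) m n (u w : 'I_m -> 'cV[R]_n) :
  dot (block_col u) (block_col w) = \sum_a dot (u a) (w a).
Proof.
rewrite /dot sum_mxtens; apply: eq_bigr => a _; apply: eq_bigr => i _.
by rewrite !mxE mxtens_indexK.
Qed.

Lemma mul_block_square (R : realType) m n (B : 'I_m -> 'I_m -> 'M[R]_n) u :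
  block_square B *m block_col u = block_col (fun a => \sum_b B a b *m u b).
Proof.
apply/colP => s; rewrite !mxE sum_mxtens summxE; apply: eq_bigr => b _.
by rewrite mxE; apply: eq_bigr => j _; rewrite !mxE mxtens_indexK.
Qed.

Lemma tensmx_block_square (R : realType) m n (E : 'M[R]_m) (F : 'M[R]_n) :
  E *t F = block_square (fun a b => E a b *: F).
Proof. by apply/matrixP => s t; rewrite !mxE. Qed.

(** * Plane vectors, and Laplacians grounded at body 1 *)

Definition cross (R : realType) (u w : 'cV[R]_2) : R :=
  u 0 0 * w 1 0 - u 1 0 * w 0 0.

Lemma dot2E (R : realType) (u w : 'cV[R]_2) :
  dot u w = u 0 0 * w 0 0 + u 1 0 * w 1 0.
Proof.
rewrite /dot !big_ord_recl big_ord0 addr0.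
by have -> : lift ord0 ord0 = 1 :> 'I_2 by apply: val_inj.
Qed.

Lemma col2P (R : realType) (u w : 'cV[R]_2) :
  u 0 0 = w 0 0 -> u 1 0 = w 1 0 -> u = w.
Proof.
move=> h0 h1; apply/colP => -[[|[|//]] i].
  by have -> : Ordinal i = 0 by apply: val_inj.
by have -> : Ordinal i = 1 by apply: val_inj.
Qed.

Lemma JmxE (R : realType) (u : 'cV[R]_2) :
  ((Jmx R *m u) 0 0 = - u 1 0) * ((Jmx R *m u) 1 0 = u 0 0).
Proof.
rewrite !mxE !big_ord_recl !big_ord0 !mxE /= !mulN1r !mul1r !mul0r !add0r !addr0.
by have -> : lift ord0 ord0 = 1 :> 'I_2 by apply: val_inj.
Qed.

Lemma dot_Jmx (R : realType) (u w : 'cV[R]_2) :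
  dot (Jmx R *m u) (Jmx R *m w) = dot u w.
Proof. by rewrite !dot2E !JmxE; ring. Qed.

Lemma dot_Jmx_self (R : realType) (u : 'cV[R]_2) : dot u (Jmx R *m u) = 0.
Proof. by rewrite dot2E !JmxE; ring. Qed.

(** From the identity (d.d) u - (d.u) d = cross(d, u) J d, checked coordinate by coordinate. *)
Lemma cross0_scale (R : realType) (d u : 'cV[R]_2) :
  d != 0 -> cross d u = 0 -> u = (dot d u / dot d d) *: d.
Proof.
move=> /dot_self_gt0 d0; rewrite /cross => c0.
rewrite mulrC -scalerA; apply: (canRL (scalerK (lt0r_neq0 d0))).
apply: col2P; rewrite !mxE !dot2E; apply/eqP; rewrite -subr_eq0; apply/eqP.
  rewrite -[RHS](mulr0 (- d 1 0)) -c0; ring.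
rewrite -[RHS](mulr0 (d 0 0)) -c0; ring.
Qed.

Lemma orth_scale_Jmx (R : realType) (q u : 'cV[R]_2) :
  q != 0 -> dot q u = 0 -> exists c, u = c *: (Jmx R *m q).
Proof.
move=> q0 qu; eexists; apply: cross0_scale.
  by rewrite -dot_self_eq0 dot_Jmx dot_self_eq0.
by rewrite /cross !JmxE mulNr -opprD addrC -dot2E qu oppr0.
Qed.

Lemma cross0_trans (R : realType) (d u w : 'cV[R]_2) :
  d != 0 -> cross d u = 0 -> cross d w = 0 -> cross u w = 0.
Proof.
move=> d0 du dw; rewrite (cross0_scale d0 du) (cross0_scale d0 dw) /cross !mxE.
ring.
Qed.

(** The condition at body 1 restores the column deleted by pinning. This serves both [gap_laplacian]
    (G = [Dmx]) and [ell] (G = alpha I). *)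
Lemma sum_grounded_laplacian (R : realType) (G : 'I_4 -> 'I_4 -> 'M[R]_2)
    (U : 'I_4 -> 'cV[R]_2) (a : 'I_3) : U body1 = 0 ->
  \sum_b (if a == b then \sum_(k < 4 | k != body_of_row a) G (body_of_row a) k
          else - G (body_of_row a) (body_of_row b)) *m U (body_of_row b)
  = \sum_k G (body_of_row a) k *m (U (body_of_row a) - U k).
Proof.
move=> U1; set i := body_of_row a.
rewrite (bigD1 a) //= eqxx mulmx_suml.
under eq_bigr => b ba do rewrite eq_sym (negPf ba) mulNmx.
rewrite [RHS](bigD1 i) //= subrr mulmx0 add0r.
under [RHS]eq_bigr do rewrite mulmxBr.
rewrite sumrB sumrN; congr (_ - _).
rewrite big_mkcond [RHS]big_mkcond [RHS]big_ord_recl /= -/body1.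
have -> : ord0 = body1 :> 'I_4 by apply: val_inj.
by rewrite U1 mulmx0 add0r.
Qed.

(** * Parallel vectors in three-space *)

Lemma ord3P (i : 'I_3) : [\/ i = 0, i = 1 | i = 2].
Proof.
by case: i => [[|[|[|//]]] lt_i3];
  [apply: Or31 | apply: Or32 | apply: Or33]; apply: val_inj.
Qed.

Lemma sum_ord3 (V : nmodType) (F : 'I_3 -> V) : \sum_a F a = F 0 + F 1 + F 2.
Proof.
rewrite !big_ord_recl big_ord0 addr0 addrA.
by congr (_ + F _ + F _); apply: val_inj.
Qed.

(** Both f and g are parallel to the nonzero cross product of x and y, hence to each other. *)
Lemma orth_pair_parallel (R : realType) (x y f g : 'I_3 -> R) a0 b0 :
  \sum_a f a * x a = 0 -> \sum_a f a * y a = 0 ->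
  \sum_a g a * x a = 0 -> \sum_a g a * y a = 0 ->
  x a0 * y b0 - x b0 * y a0 != 0 -> forall a b, f a * g b = f b * g a.
Proof.
(* [n] is the cross product x × y. *)
pose n (i : 'I_3) := [:: x 1 * y 2 - x 2 * y 1; x 2 * y 0 - x 0 * y 2;
                         x 0 * y 1 - x 1 * y 0]`_i.
have par h : \sum_a h a * x a = 0 -> \sum_a h a * y a = 0 ->
    forall a b, h a * n b = h b * n a.
  rewrite !sum_ord3 => hx hy a b.
  (* The entries of h × n follow from h × (x × y) = x (h.y) - y (h.x). *)
  have X c : y c * (h 0 * x 0 + h 1 * x 1 + h 2 * x 2) = 0 by rewrite hx mulr0.
  have Y c : x c * (h 0 * y 0 + h 1 * y 1 + h 2 * y 2) = 0 by rewrite hy mulr0.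
  have [X0 X1 X2] := And3 (X 0) (X 1) (X 2).
  have [Y0 Y1 Y2] := And3 (Y 0) (Y 1) (Y 2).
  by case: (ord3P a) => ->; case: (ord3P b) => ->; rewrite /n /=; lra.
move=> fx fy gx gy xy0.
have [k nk] : exists k, n k != 0.
  (* The given nonzero minor is, up to sign, the entry of [n] at the third index. *)
  case: (ord3P a0) xy0 => ->; case: (ord3P b0) => ->; rewrite ?subrr ?eqxx // => xy0;
    by [exists 0 | exists 1 | exists 2 | exists 0; rewrite -oppr_eq0 /n /= opprB
       | exists 1; rewrite -oppr_eq0 /n /= opprB
       | exists 2; rewrite -oppr_eq0 /n /= opprB].
move=> a b; apply: (mulIf nk).
rewrite mulrAC (par f) // [RHS]mulrAC (par f fx fy b) // -!mulrA; congr (_ * _).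
by rewrite mulrC (par g) // mulrC.
Qed.

(** * Relative positions and pair coefficients *)

Section Configuration.

Variables (R : realType) (m : 'I_4 -> R) (r : 'I_4 -> 'cV[R]_2) (omega2 : R).
Hypotheses (m_gt0 : forall i, 0 < m i) (r_inj : injective r).

Local Notation q := (qvec r).
Local Notation J := (Jmx R).
Local Notation row := body_of_row.

Lemma qvec_opp i j : q j i = - q i j.
Proof. by rewrite /qvec opprB. Qed.

Lemma qvec_neq0 i j : i != j -> q i j != 0.
Proof. by rewrite subr_eq0 (inj_eq r_inj). Qed.

Lemma qvec_body1B i j : q body1 i - q body1 j = q j i.
Proof. by rewrite /qvec opprB addrC addrA subrK. Qed.

Lemma qvec_row_neq0 a : q body1 (row a) != 0.
Proof. exact/qvec_neq0/neq_lift. Qed.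

Lemma qdistC i j : qdist r i j = qdist r j i.
Proof.
by rewrite /qdist /norm2 [qvec r j i]qvec_opp dotNl dotNr opprK.
Qed.

Lemma qdist_gt0 i j : i != j -> 0 < qdist r i j.
Proof. by move=> ij; rewrite sqrtr_gt0 dot_self_gt0 ?qvec_neq0. Qed.

Lemma muC i j : mu m i j = mu m j i.
Proof. by rewrite /mu [m i * _]mulrC. Qed.

Lemma alpha_perpC i j : alpha_perp m r omega2 i j = alpha_perp m r omega2 j i.
Proof. by rewrite /alpha_perp muC qdistC. Qed.

Lemma total_mass_gt0 : 0 < total_mass m.
Proof.
rewrite /total_mass (bigD1 body1) //= ltr_pwDl // sumr_ge0 // => i _.
exact: ltW.
Qed.

(** Absorbs the normalization of the unit vectors: D_ij = [stiffness i j] q_ij q_ij^T. *)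
Definition stiffness i j : R := delta m r i j / qdist r i j ^+ 2.

Lemma stiffness_gt0 i j : i != j -> 0 < stiffness i j.
Proof.
move=> ij; rewrite /stiffness /delta /mu.
by do ?[rewrite divr_gt0 // | rewrite mulr_gt0 // | rewrite exprn_gt0 ];
  rewrite ?qdist_gt0 ?total_mass_gt0.
Qed.

Lemma stiffnessC i j : stiffness i j = stiffness j i.
Proof. by rewrite /stiffness /delta muC qdistC. Qed.

Lemma mul_Dmx i j u : Dmx m r i j *m u = (stiffness i j * dot (q i j) u) *: q i j.
Proof.
rewrite /Dmx /qhat -scalemxAl linearZ /= -mulmxA -!scalemxAl -scalemxAr.
rewrite [_^T *m u]mx11_scalar -dotE mul_mx_scalar !scalerA /stiffness.
by congr (_ *: _); rewrite expr2 invfM; ring.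
Qed.

(** * Gap Laplacian: energy, symmetry and rotational mode *)

Lemma gap_laplacian_mul (U : 'I_4 -> 'cV[R]_2) : U body1 = 0 ->
  gap_laplacian m r *m block_col (fun a => U (row a)) =
  block_col (fun a => \sum_k Dmx m r (row a) k *m (U (row a) - U k)).
Proof.
move=> U1; rewrite mul_block_square; apply: eq_block_col => a.
exact: sum_grounded_laplacian.
Qed.

(** Elastic energy of the displacement U; the factor 1/2 appears because every pair is counted
    twice. *)
Lemma gap_laplacian_energy (U : 'I_4 -> 'cV[R]_2) : U body1 = 0 ->
  let x := block_col (fun a => U (row a)) in
  dot x (gap_laplacian m r *m x) =
  2^-1 * \sum_i \sum_k stiffness i k * dot (q i k) (U i - U k) ^+ 2.
Proof.
move=> U1 x; rewrite gap_laplacian_mul // dot_block_col.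
pose e i k := stiffness i k * dot (q i k) (U i - U k).
have eE a : dot (U (row a)) (\sum_k Dmx m r (row a) k *m (U (row a) - U k)) =
    \sum_k e (row a) k * dot (q (row a) k) (U (row a)).
  rewrite dotE mulmx_sumr summxE; apply: eq_bigr => k _.
  by rewrite -dotE mul_Dmx dotZr (dotC (U _) (q _ _)).
under eq_bigr do rewrite eE.
(* Body 1 can join the outer sum because its displacement is zero. *)
have -> : \sum_a \sum_k e (row a) k * dot (q (row a) k) (U (row a)) =
    \sum_i \sum_k e i k * dot (q i k) (U i).
  have ord01 : ord0 = body1 :> 'I_4 by apply: val_inj.
  rewrite [RHS]big_ord_recl ord01 [X in X + _]big1 ?add0r // => k _.
  by rewrite U1 dot0r mulr0.
have qN i k u : dot (q i k) u = - dot (q k i) u.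
  by rewrite [q i k]qvec_opp dotNl.
have eC i k : e i k = e k i.
  by rewrite /e stiffnessC qN -(opprB (U k) (U i)) dotNr opprK.
apply: (mulfI (x := 2)); rewrite ?mulVKf ?pnatr_eq0 //.
(* Symmetry of [e] splits each squared term into two halves that agree after exchanging i and k. *)
have -> : \sum_i \sum_k stiffness i k * dot (q i k) (U i - U k) ^+ 2 =
    \sum_i \sum_k (e i k * dot (q i k) (U i) + e k i * dot (q k i) (U k)).
  apply: eq_bigr => i _; apply: eq_bigr => k _.
  rewrite (eC k i) [dot (q k i) _]qN /e dotDr dotNr; ring.
under [RHS]eq_bigr do rewrite big_split.
by rewrite big_split /= [X in _ = _ + X]exchange_big /= mulr_natl mulr2n.
Qed.

Lemma gap_laplacian_sym : (gap_laplacian m r)^T = gap_laplacian m r.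
Proof.
have DT i j : (Dmx m r i j)^T = Dmx m r i j.
  by rewrite /Dmx linearZ /= trmx_mul trmxK.
have DC i j : Dmx m r i j = Dmx m r j i.
  rewrite /Dmx /qhat /delta muC qdistC [q i j]qvec_opp.
  by rewrite scalerN linearN /= mulmxN mulNmx opprK.
apply/matrixP => s t; rewrite !mxE eq_sym.
have E (M : 'M[R]_2) i j : M i j = M^T j i by rewrite mxE.
have [->|_] := eqVneq; rewrite [LHS]E; congr (fun_of_matrix _ _ _).
  by rewrite linear_sum; apply: eq_bigr => k _; exact: DT.
by rewrite linearN /= DT DC.
Qed.

Lemma rot_modeE : rot_mode r = block_col (fun a => J *m q body1 (row a)).
Proof.
rewrite /rot_mode tensmx_block_square mul_block_square.
apply: eq_block_col => a; rewrite (bigD1 a) //= big1 => [|b ba].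
  by rewrite mxE eqxx scale1r addr0.
by rewrite mxE eq_sym (negPf ba) scale0r mul0mx.
Qed.

Lemma rot_mode_neq0 : rot_mode r != 0.
Proof.
rewrite -dot_self_eq0 rot_modeE dot_block_col gt_eqF // big_ord_recl.
rewrite ltr_pwDl ?dot_Jmx ?dot_self_gt0 ?qvec_row_neq0 //.
by apply: sumr_ge0 => a _; exact: dot_self_ge0.
Qed.

(** A rotation moves each q_ij orthogonally to itself, so every [Dmx] term vanishes. *)
Lemma gap_laplacian_rot_mode : gap_laplacian m r *m rot_mode r = 0.
Proof.
rewrite rot_modeE (gap_laplacian_mul (U := fun i => J *m q body1 i)); last first.
  by rewrite /qvec subrr mulmx0.
rewrite -[RHS](block_col0 R 3 2); apply: eq_block_col => a; apply: big1 => k _.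
by rewrite -mulmxBr qvec_body1B mul_Dmx [q k _]qvec_opp mulmxN dotNr
  dot_Jmx_self oppr0 mulr0 scale0r.
Qed.

(** * Noncollinearity and rigidity *)

Hypothesis noncollinear : ~ on_a_line r.

Lemma noncollinear_cross : exists a b, cross (q body1 (row a)) (q body1 (row b)) != 0.
Proof.
have [/existsP[a /existsP[b ab]]|/existsPn par] :=
  boolP [exists a, exists b, cross (q body1 (row a)) (q body1 (row b)) != 0].
  by exists a, b.
(* Otherwise every q_1a is parallel to q_12, and all bodies lie on the line through body 1 in that
   direction. *)
case: noncollinear; exists (r body1), (q body1 (row 0)).
split=> [|i]; first exact: qvec_row_neq0.
case: (unliftP body1 i) => [a|] ->; last by exists 0; rewrite scale0r addr0.
have /existsPn/(_ a)/negPn/eqP /(cross0_scale (qvec_row_neq0 0)) qa := par 0.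
set t := _ / _ in qa; exists (- t); rewrite scaleNr -qa.
by rewrite /qvec opprB addrC subrK.
Qed.

(* The complete graph on four points of the plane that are not all on a line is
   infinitesimally rigid; body 1 is pinned, so only the rotations remain. *)
Lemma infinitesimally_rigid (U : 'I_4 -> 'cV[R]_2) : U body1 = 0 ->
  (forall i j, dot (q i j) (U i - U j) = 0) ->
  exists c, forall a, U (row a) = c *: (J *m q body1 (row a)).
Proof.
move=> U1 qU; have [a0 [b0 ab]] := noncollinear_cross.
have /fin_all_exists[c cE] a : exists c, U (row a) = c *: (J *m q body1 (row a)).
  apply: orth_scale_Jmx; first exact: qvec_row_neq0.
  have := qU body1 (row a).
  by rewrite U1 sub0r dotNr => /eqP; rewrite oppr_eq0 => /eqP.
(* The condition on the pair (b, a) reads (c_a - c_b) cross(q_1a, q_1b) = 0. *)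
have c_eq a b : cross (q body1 (row a)) (q body1 (row b)) != 0 -> c a = c b.
  have := qU (row b) (row a); rewrite -qvec_body1B !cE.
  move: (q body1 (row a)) (q body1 (row b)) => qa qb e ab0.
  have /eqP : (c a - c b) * cross qa qb = 0.
    by rewrite -[RHS]e /cross !(dotDl, dotDr, dotNl, dotNr, dotZr) !dot2E !JmxE; ring.
  by rewrite mulf_eq0 (negPf ab0) orbF subr_eq0 => /eqP.
exists (c a0) => a; rewrite cE; congr (_ *: _).
(* If q_1a is parallel to q_1a0, it is not parallel to q_1b0, and the comparison passes through
   b0. *)
have [ca|/c_eq//] := eqVneq (cross (q body1 (row a)) (q body1 (row a0))) 0.
rewrite (c_eq a0 b0) //; apply: c_eq; apply: contra ab => /eqP cb.
by apply/eqP; apply: cross0_trans ca cb; exact: qvec_row_neq0.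
Qed.

(** Zero energy makes every pair term vanish; by rigidity x is then a multiple of v, and
    orthogonality to v leaves x = 0. *)
Lemma gap_laplacian_posdef : posdef_on_orth (rot_mode r) (gap_laplacian m r).
Proof.
move=> x x0 vx; pose u a : 'cV[R]_2 := \col_i x (mxtens_index (a, i)) 0.
(* Extends x to all four bodies, with displacement 0 at the pinned body 1. *)
pose U i := if unlift body1 i is Some a then u a else 0.
have U1 : U body1 = 0 by rewrite /U unlift_none.
have xE : x = block_col (fun a => U (row a)).
  by rewrite [LHS]block_colE; apply: eq_block_col => a; rewrite /U liftK.
have t_ge0 i k : 0 <= stiffness i k * dot (q i k) (U i - U k) ^+ 2.
  have [->|ik] := eqVneq i k; first by rewrite subrr dot0r expr0n mulr0.
  by rewrite mulr_ge0 ?sqr_ge0 // ltW // stiffness_gt0.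
have S_ge0 i : 0 <= \sum_k stiffness i k * dot (q i k) (U i - U k) ^+ 2.
  by apply: sumr_ge0.
rewrite {1 2}xE gap_laplacian_energy // mulr_gt0 ?invr_gt0 //.
rewrite lt_def sumr_ge0 // andbT; apply: contra x0 => /eqP S0.
have qU i j : dot (q i j) (U i - U j) = 0.
  have [->|ij] := eqVneq i j; first by rewrite subrr dot0r.
  have /eqP := psumr_eq0P (fun k _ => t_ge0 i k)
    (psumr_eq0P (fun k _ => S_ge0 k) S0 (i := i) isT) (i := j) isT.
  by rewrite mulf_eq0 gt_eqF ?stiffness_gt0 //= sqrf_eq0 => /eqP.
have [c Uc] := infinitesimally_rigid U1 qU.
have xc : x = c *: rot_mode r.
  by rewrite xE rot_modeE block_colZ; exact: eq_block_col.
have /eqP := vx; rewrite xc dotZr mulf_eq0 dot_self_eq0 (negPf rot_mode_neq0) orbF.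
by move/eqP->; rewrite scale0r.
Qed.

(** * Equilibrium stress of a central configuration *)

Hypothesis barycenter0 : \sum_i m i *: r i = 0.
Hypothesis central : central_eq m r omega2.

Local Notation alpha := (alpha_perp m r omega2).
Local Notation ell := (ell m r omega2).

(** With barycenter 0, the sum of mu_ik q_ik is m_i r_i, so the [omega2] part is omega2 m_i r_i,
    which the central equation cancels against the attraction terms. *)
Lemma central_stress i : \sum_k alpha i k *: q i k = 0.
Proof.
have mu_q : \sum_k mu m i k *: q i k = m i *: r i.
  have -> : \sum_k mu m i k *: q i k = (m i / total_mass m) *: \sum_k m k *: q i k.
    rewrite scaler_sumr; apply: eq_bigr => k _; rewrite scalerA /mu; congr (_ *: _).
    ring.
  under eq_bigr do rewrite scalerBr.
  rewrite sumrB barycenter0 subr0 -scaler_suml scalerA divfK //.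
  exact/lt0r_neq0/total_mass_gt0.
have M0 : total_mass m != 0 by exact/lt0r_neq0/total_mass_gt0.
under eq_bigr => k _.
  have -> : alpha i k *: q i k =
      omega2 *: (mu m i k *: q i k) - (m i * m k / qdist r i k ^+ 3) *: q i k.
    rewrite scalerA -scalerBl; congr (_ *: _); rewrite /alpha_perp /mu.
    by move: (qdist r i k ^+ 3)^-1 => x; field.
  over.
rewrite sumrB -scaler_sumr mu_q scalerA central [X in _ - X](bigD1 i) //=.
by rewrite /= [q i i]subrr scaler0 add0r subrr.
Qed.

(** As q_11 = 0, the grounded-Laplacian formula applies to the q_1b and yields minus the stress sum
    at body [row a]. *)
Lemma ell_kernel a : \sum_b ell a b *: q body1 (row b) = 0.
Proof.
pose G i k : 'M[R]_2 := (alpha i k)%:M.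
transitivity (\sum_k G (row a) k *m (q body1 (row a) - q body1 k)).
  rewrite -(@sum_grounded_laplacian _ G (q body1)) ?[q body1 body1]subrr //.
  apply: eq_bigr => b _; rewrite mxE; case: eqP => _.
    by rewrite -mul_scalar_mx raddf_sum.
  by rewrite /G mulNmx mul_scalar_mx scaleNr.
apply: oppr_inj; rewrite oppr0 -[RHS](central_stress (row a)) -sumrN.
apply: eq_bigr => k _.
by rewrite mul_scalar_mx qvec_body1B [q k _]qvec_opp scalerN opprK.
Qed.

(** Every row of [ell] is orthogonal to the two coordinate vectors of the q_1b, which are
    independent by noncollinearity; hence the rows are parallel. *)
Lemma ell_minor a b c d : ell a c * ell b d = ell a d * ell b c.
Proof.
have [a0 [b0 ab]] := noncollinear_cross.
have K e i : \sum_b ell e b * q body1 (row b) i 0 = 0.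
  have /(congr1 (fun M : 'cV_2 => M i 0)) := ell_kernel e.
  rewrite summxE [RHS]mxE => e0; rewrite -[RHS]e0.
  by apply: eq_bigr => f _; rewrite [RHS]mxE.
apply: (orth_pair_parallel (f := ell a) (K a 0) (K a 1) (K b 0) (K b 1) (a0 := a0) (b0 := b0)).
by move: ab; rewrite /cross [X in _ - X]mulrC.
Qed.

(** * Factorization of [ell] and [Ltilde] *)

Hypotheses (a23 : alpha body2 body3 != 0) (a24 : alpha body2 body4 != 0).
Hypothesis a34 : alpha body3 body4 != 0.

Local Notation sigma := (sigma m r omega2).
Local Notation w := (wvec m r omega2).

Lemma ell_factor : ell = sigma *: (w *m w^T).
Proof.
have row0 : row 0 = body2 by exact: val_inj.
have row1 : row 1 = body3 by exact: val_inj.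
have row2 : row 2 = body4 by exact: val_inj.
have off a b : a != b -> ell a b = - alpha (row a) (row b).
  by move=> ab; rewrite mxE (negPf ab).
have wE a b : (sigma *: (w *m w^T)) a b = sigma * (w a 0 * w b 0).
  by rewrite !mxE big_ord1 !mxE.
(* Each of these minors contains one diagonal entry and three off-diagonal ones, so it determines
   the diagonal entry. *)
have e00 := ell_minor 0 1 0 2; have e11 := ell_minor 1 0 1 2.
have e22 := ell_minor 2 0 2 1.
have e01 : ell 0 1 = - alpha body2 body3 by rewrite off // row0 row1.
have e02 : ell 0 2 = - alpha body2 body4 by rewrite off // row0 row2.
have e12 : ell 1 2 = - alpha body3 body4 by rewrite off // row1 row2.
have e10 : ell 1 0 = - alpha body2 body3 by rewrite off // row0 row1 alpha_perpC.
have e20 : ell 2 0 = - alpha body2 body4 by rewrite off // row0 row2 alpha_perpC.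
have e21 : ell 2 1 = - alpha body3 body4 by rewrite off // row1 row2 alpha_perpC.
move: e00 e11 e22; rewrite e01 e02 e12 e10 e21 => e00 e11 e22.
have {}e00 : ell 0 0 = - (alpha body2 body3 * alpha body2 body4 / alpha body3 body4).
  by apply: (mulIf a34); rewrite mulNr divfK // -[LHS]opprK -mulrN e00; ring.
have {}e11 : ell 1 1 = - (alpha body2 body3 * alpha body3 body4 / alpha body2 body4).
  by apply: (mulIf a24); rewrite mulNr divfK // -[LHS]opprK -mulrN e11; ring.
have {}e22 : ell 2 2 = - (alpha body2 body4 * alpha body3 body4 / alpha body2 body3).
  by apply: (mulIf a23); rewrite mulNr divfK // -[LHS]opprK -mulrN e22; ring.
apply/matrixP => a b; rewrite wE.
case: (ord3P a) => ->; case: (ord3P b) => ->;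
  rewrite ?(e00, e01, e02, e10, e11, e12, e20, e21, e22) !mxE /= /Defs.sigma;
  by field; rewrite ?a23 ?a24 ?a34.
Qed.

Lemma sigma_neq0 : sigma != 0.
Proof. by rewrite oppr_eq0; exact: mulf_neq0 (mulf_neq0 a23 a24) a34. Qed.

Lemma Ltilde_factor :
  Ltilde m r omega2 = sigma *: (Wmx m r omega2 *m (Wmx m r omega2)^T).
Proof.
have -> : Wmx m r omega2 *m (Wmx m r omega2)^T = (w *m w^T) *t 1%:M.
  have trW : (Wmx m r omega2)^T = (w^T *t 1%:M : 'M_(1 * 2, 3 * 2)).
    by apply/matrixP => i j; rewrite !mxE [in LHS]eq_sym.
  (* The inner dimension 2 is read as the convertible [1 * 2], where the mixed-product rule for
     Kronecker products applies. *)
  rewrite trW; transitivity ((w *t (1%:M : 'M[R]_2)) *m (w^T *t (1%:M : 'M[R]_2))) => //.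
  by rewrite tensmx_mul mulmx1.
rewrite /Ltilde ell_factor; apply/matrixP => s t; by rewrite !mxE mulrA.
Qed.

Lemma WmxE a (i j : 'I_2) :
  Wmx m r omega2 (mxtens_index (a, i)) j = w a 0 * (i == j)%:R.
Proof.
rewrite mxE mxtens_indexK (ord1 (mxtens_unindex _).1) [1%:M _ _]mxE /=.
by congr (_ * (_ == _)%:R); apply: val_inj; rewrite /= modn_small.
Qed.

(** The first block of W is the invertible matrix I_2 / alpha_34. *)
Lemma Wmx_inj (y : 'cV_2) : Wmx m r omega2 *m y = 0 -> y = 0.
Proof.
move=> Wy; have w0 : w 0 0 != 0 by rewrite mxE /= invr_eq0.
apply/colP => i; rewrite [RHS]mxE; apply: (mulfI w0); rewrite mulr0.
have /(congr1 (fun M : 'cV_(3 * 2) => M (mxtens_index (0, i)) 0)) := Wy.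
rewrite [RHS]mxE mxE (bigD1 i) //= big1 => [|j ji].
  by rewrite WmxE eqxx mulr1 addr0.
by rewrite WmxE eq_sym (negPf ji) mulr0 mul0r.
Qed.

(** As sigma W is injective, it suffices that [Ltilde] kills v. Its blocks there are J applied to
    the sums of [ell_kernel]. *)
Lemma Wmx_rot_mode : (Wmx m r omega2)^T *m rot_mode r = 0.
Proof.
apply: Wmx_inj; apply: (scalerI sigma_neq0).
rewrite mulmxA scalemxAl -Ltilde_factor scaler0 rot_modeE.
rewrite /Ltilde tensmx_block_square mul_block_square -[RHS](block_col0 R 3 2).
apply: eq_block_col => a.
under eq_bigr do rewrite -scalemxAl mul1mx scalemxAr.
by rewrite -mulmx_sumr ell_kernel mulmx0.
Qed.

End Configuration.

(** * Spectrum of [Omega] and positivity of the restricted Hessian *)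

Theorem proposition5p11 (R : realType) (m : 'I_4 -> R) (r : 'I_4 -> 'cV[R]_2)
    (omega2 : R)
    (m_gt0 : forall i, 0 < m i)
    (r_inj : injective r)
    (barycenter0 : \sum_i m i *: r i = 0)
    (omega2_gt0 : 0 < omega2)
    (central : central_eq m r omega2)
    (noncollinear : ~ on_a_line r)
    (alpha23_neq0 : alpha_perp m r omega2 body2 body3 != 0)
    (alpha24_neq0 : alpha_perp m r omega2 body2 body4 != 0)
    (alpha34_neq0 : alpha_perp m r omega2 body3 body4 != 0) :
  (forall lam : R,
     (lam != 0 /\ gen_eigenvalue_on_orth (rot_mode r) (Ltilde m r omega2)
                    (gap_laplacian m r) lam)
     <-> eigenvalue (Omega m r omega2) lam) /\
  (exists lam1 lam2 : R,
     char_poly (Omega m r omega2) = ('X - lam1%:P) * ('X - lam2%:P) /\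
     (posdef_on_orth (rot_mode r) (restricted_hessian m r omega2)
      <-> (-1 < lam1 /\ -1 < lam2))).
Proof.
have v0 := rot_mode_neq0 r_inj; have sL := gap_laplacian_sym m r.
have Lv := gap_laplacian_rot_mode m r.
have Lpd := gap_laplacian_posdef m_gt0 r_inj noncollinear.
have Winj := Wmx_inj alpha34_neq0.
have s0 := sigma_neq0 alpha23_neq0 alpha24_neq0 alpha34_neq0.
have LtE := Ltilde_factor m_gt0 r_inj noncollinear barycenter0 central
  alpha23_neq0 alpha24_neq0 alpha34_neq0.
have Wv := Wmx_rot_mode m_gt0 r_inj noncollinear barycenter0 central
  alpha23_neq0 alpha24_neq0 alpha34_neq0.
have sOm : (Omega m r omega2)^T = Omega m r omega2 by exact: capacitance_sym.
rewrite /restricted_hessian LtE; split=> [lam|].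
  exact: capacitance_eigenvalueP.
(* Symmetry of [Omega] makes both eigenvalues real; [s] and [p] record trace and determinant. *)
have [l1 [l2 [chi s p]]] := sym_mx22_char_poly_split sOm.
exists l1, l2; split=> //; split=> [Hpd|[l1_gt l2_gt]].
  have gtN1 lam : root (char_poly (Omega m r omega2)) lam -> -1 < lam.
    by rewrite -eigenvalue_root_char; apply: eigenvalue_gtN1 Hpd.
  by split; apply: gtN1; rewrite chi rootM !root_XsubC eqxx ?orbT.
apply: posdef_perturbation => // y y0.
exact: sym_mx22_posdef_shift sOm s p l1_gt l2_gt y0.
Qed.
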